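(* Let $h\in\mathcal D$ and suppose that the distortion risk measure $\rho=\rho_h$ on $L^1$ is coherent (equivalently, $h$ is concave). If $h$ is not the identity on $[0,1]$, then $$1\le s_\rho\le \frac{h(1/2)+1/2}{h(1/2)-1/2}<\infty .$$ As a consequence, for a coherent distortion risk measure $\rho$ on $L^1$, $s_\rho=\infty$ if and only if $\rho$ is the mean, i.e. $\rho=\mathbb E$.
   Context: Fix an atomless probability space $(\Omega,\mathcal F,\mathbb P)$; random variables are real-valued and almost surely equal ones are identified; $L^1$ is the set of integrable random variables. Write $x\vee y=\max\{x,y\}$. $\mathcal D$ is the set of (non-strictly) increasing functions $h:[0,1]\to[0,1]$ with $h(0)=0$ and $h(1)=1$ (no continuity is assumed; a concave $h\in\mathcal D$ may jump at $0$). For $h\in\mathcal D$, the distortion risk measure with distortion function $h$ is $$\rho_h(X)=\int_0^\infty h(\mathbb P(X>x))\,dx+\int_{-\infty}^0\big(h(\mathbb P(X>x))-1\big)\,dx .$$ When $h$ is concave this is well-defined on $L^1$ with values in $(-\infty,\infty]$. A risk measure $\rho:L^1\to(-\infty,\infty]$ (finite on constants) is coherent if it satisfies: monotonicity ($\rho(X)\le\rho(Y)$ if $X\le Y$), cash invariance ($\rho(X+c)=\rho(X)+c$ for $c\in\mathbb R$), convexity ($\rho(\lambda X+(1-\lambda)Y)\le\lambda\rho(X)+(1-\lambda)\rho(Y)$ for $\lambda\in(0,1)$) and positive homogeneity ($\rho(\lambda X)=\lambda\rho(X)$ for $\lambda>0$). It is a known fact that $\rho_h$ is coherent if and only if $h$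 is concave. The folding score of $\rho$ is $$s_\rho=\sup_{X\in L^1}\frac{\rho(|X|)}{|\rho(X)|\vee|\rho(-X)|}\in[0,\infty],$$ with the conventions $\infty/\infty=1$, $0/0=1$, and $a/0=\infty$ for $a>0$. *)

(* Defs.v *)
From HB Require Import structures.
From mathcomp Require Import all_boot all_order all_algebra.
From mathcomp Require Import all_classical all_reals all_analysis.

Set Implicit Arguments.
Unset Strict Implicit.
Unset Printing Implicit Defensive.

Import Order.TTheory GRing.Theory Num.Theory.
Import numFieldNormedType.Exports.

Local Open Scope classical_set_scope.
Local Open Scope ring_scope.

Definition atomless d (T : measurableType d) (R : realType)
    (P : probability T R) : Prop :=
  forall A, measurable A -> (0 < P A)%E ->
    exists B, [/\ measurable B, B `<=` A, (0 < P B)%E & (P B < P A)%E].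

(* Only the values of [h] on [0, 1] matter. *)
Record distortion (R : realType) (h : R -> R) : Prop := Distortion {
  distortion_range : forall t, t \in `[0, 1] -> h t \in `[0, 1] ;
  distortion_ndecr : {in `[0, 1] &, {homo h : s t / s <= t}} ;
  distortion0 : h 0 = 0 ;
  distortion1 : h 1 = 1 }.

(* The first integral lies in [0, +oo] and the second one in [-oo, 0]; the
   only indeterminate sum, +oo - oo, evaluates to -oo in [\bar R], a value
   that [coherent] excludes. *)
Definition distortion_rm d (T : measurableType d) (R : realType)
    (P : probability T R) (h : R -> R) (X : T -> R) : \bar R :=
  (\int[lebesgue_measure]_(x in `[0%R, +oo[)
      (h (fine (P [set w | x < X w]%R)))%:E
   + \int[lebesgue_measure]_(x in `]-oo, 0%R])
      (h (fine (P [set w | x < X w]%R)) - 1)%:E)%E.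

(* Random variables are represented by functions in [Lfun P 1]. Since
   [coherent_mono] uses the almost sure order, a coherent [rho] takes the same
   value on almost surely equal functions. *)
Record coherent d (T : measurableType d) (R : realType)
    (P : probability T R) (rho : (T -> R) -> \bar R) : Prop := Coherent {
  coherent_gtNy : forall X, X \in Lfun P 1 -> (-oo < rho X)%E ;
  coherent_cst : forall c : R, rho (cst c) \is a fin_num ;
  coherent_mono : forall X Y, X \in Lfun P 1 -> Y \in Lfun P 1 ->
    {ae P, forall w, X w <= Y w} -> (rho X <= rho Y)%E ;
  coherent_cash : forall X (c : R), X \in Lfun P 1 ->
    rho (fun w => X w + c) = (rho X + c%:E)%E ;
  coherent_convex : forall X Y (l : R), X \in Lfun P 1 -> Y \in Lfun P 1 ->
    0 < l < 1 ->
    (rho (fun w => l * X w + (1 - l) * Y w)%R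
      <= l%:E * rho X + (1 - l)%:E * rho Y)%E ;
  coherent_homog : forall X (l : R), X \in Lfun P 1 -> 0 < l ->
    rho (fun w => l * X w) = (l%:E * rho X)%E }.

(* Division on [0, +oo] with oo/oo = 0/0 = 1. The remaining conventions
   a/0 = oo for a > 0 and a/oo = 0 for a < oo already hold for the division
   of [\bar R]. *)
Definition eratio (R : realType) (a b : \bar R) : \bar R :=
  if ((a == 0) && (b == 0) || (a == +oo) && (b == +oo))%E then 1%E
  else (a / b)%E.

Definition folding_score d (T : measurableType d) (R : realType)
    (P : probability T R) (rho : (T -> R) -> \bar R) : \bar R :=
  ereal_sup [set eratio (rho (fun w => `|X w|%R))
                        (maxe `|rho X|%E `|rho (fun w => (- X w)%R)|%E)
            | X in [set X : T -> R | X \in Lfun P 1]].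

(* Main.v *)
(* Write [a = h (1/2)], [p = rho X^+], [q = rho X^-], [u = rho (- X^+)] and
   [v = rho (- X^-)], so that [rho X = p + v] and [rho (- X) = q + u], while
   [rho |X| <= p + q] and [0 <= q + v] by subadditivity. Up to exchanging [X]
   and [- X], the event [X > 0] has probability at most [1/2], where concavity
   gives [a (1 - h (1 - t)) <= (1 - a) h t]; integrating, [- a u <= (1 - a) p],
   and [(2 a - 1) (p + q) <= (2 a + 1) max (|rho X|) (|rho (- X)|)] follows.
   Concavity of [h] comes from convexity of [rho] on indicators of events with
   prescribed probabilities, which exist because [P] is atomless. If [rho] is
   the mean, a fair sign has [rho X = rho (- X) = 0] and [rho |X| = 1]. *)
Require Import Defs.
From HB Require Import structures.
From mathcomp Require Import all_boot all_order all_algebra.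
From mathcomp Require Import all_classical all_reals all_analysis.
From mathcomp Require Import measurable_realfun lra.
Import Order.TTheory GRing.Theory Num.Theory.
Import numFieldNormedType.Exports.
Local Open Scope classical_set_scope.
Local Open Scope ring_scope.

(** * Sets of prescribed probability in an atomless space *)

Section atomless.
Set Implicit Arguments.
Unset Strict Implicit.
Context d (T : measurableType d) (R : realType) (P : probability T R).
Implicit Types A B : set T.

Lemma fine_prob_ge0 A : 0 <= fine (P A).
Proof. by rewrite fine_ge0. Qed.

Lemma fine_prob_le1 A : measurable A -> fine (P A) <= 1.
Proof.
by move=> mA; rewrite -lee_fin fineK ?fin_num_measure// probability_le1.
Qed.

Lemma le_fine_prob A B : measurable A -> measurable B -> A `<=` B ->
  fine (P A) <= fine (P B).
Proof.
move=> mA mB AB; rewrite fine_le ?fin_num_measure//.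
by rewrite le_measure ?inE.
Qed.

Lemma fine_probU A B : measurable A -> measurable B -> A `&` B = set0 ->
  fine (P (A `|` B)) = fine (P A) + fine (P B).
Proof.
by move=> mA mB AB; rewrite measureU// fineD// fin_num_measure.
Qed.

Lemma fine_probD A B : measurable A -> measurable B -> B `<=` A ->
  fine (P (A `\` B)) = fine (P A) - fine (P B).
Proof.
move=> mA mB BA; rewrite -[in RHS](setDUK BA) fine_probU ?setDIK//.
- by rewrite addrAC subrr add0r.
- exact: measurableD.
Qed.

Lemma fine_probC A : measurable A -> fine (P (~` A)) = 1 - fine (P A).
Proof.
by move=> mA; rewrite -setTD fine_probD// probability_setT.
Qed.

Hypothesis P_atomless : atomless P.

(** Repeated halving: when a set is cut into two parts of positive probability, one of them has at
    most half of it. After [n] cuts the probability is at most [2 ^- n]. *)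
Lemma atomless_subset_lt A (e : R) : measurable A -> 0 < fine (P A) -> 0 < e ->
  exists B, [/\ measurable B, B `<=` A & 0 < fine (P B) < e].
Proof.
move=> mA A0 e0.
have halving n : exists B,
    [/\ measurable B, B `<=` A, 0 < fine (P B) & fine (P B) * 2 ^+ n <= 1].
  elim: n => [|n [B [mB BA B0 Bn]]].
    by exists A; split => //; rewrite expr0 mulr1 fine_prob_le1.
  have [|C [mC CB C0 CltB]] := P_atomless mB.
    by rewrite -(@fineK _ (P B)) ?fin_num_measure// lte_fin.
  have C0' : 0 < fine (P C) by rewrite fine_gt0// C0 (lt_le_trans CltB)// leey.
  have CltB' : fine (P C) < fine (P B).
    by rewrite -lte_fin !fineK// fin_num_measure.
  have [CB2|CB2] := leP (fine (P C) * 2) (fine (P B)).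
    exists C; split => //; first exact: subset_trans BA.
    by rewrite exprS mulrA (le_trans _ Bn)// ler_wpM2r// exprn_ge0.
  exists (B `\` C); split.
  - exact: measurableD.
  - by move=> x [/BA].
  - by rewrite fine_probD// subr_gt0.
  - rewrite exprS mulrA (le_trans _ Bn)// ler_wpM2r ?exprn_ge0// fine_probD//.
    lra.
have [n ne] : exists n, e^-1 < 2 ^+ n.
  exists (Num.bound e^-1); have en := archi_boundP (ltW (eqbRL (invr_gt0 e) e0)).
  by rewrite (lt_trans en)// -natrX ltr_nat ltn_expl.
have [B [mB BA B0 Bn]] := halving n.
exists B; split => //; rewrite B0/=.
rewrite -(@ltr_pM2r _ (2 ^+ n)) ?exprn_gt0// (le_lt_trans Bn)//.
by rewrite -(@ltr_pM2l _ e^-1) ?invr_gt0// mulrA mulVf ?gt_eqF// mulr1 mul1r.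
Qed.

(* Sierpinski's theorem, by exhaustion: a set [E] of measure at most [c] is
   enlarged repeatedly by at least half of the largest possible amount. *)
Lemma atomless_subset A (c : R) : measurable A -> 0 <= c <= fine (P A) ->
  exists B, [/\ measurable B, B `<=` A & fine (P B) = c].
Proof.
move=> mA /andP[c0 cA].
pose good E := [/\ measurable E, E `<=` A & fine (P E) <= c].
(* The implication stands under the existential so that [choice] yields a total map on sets; the
   value outside [good] is arbitrary. *)
have next E : exists F, good E ->
    [/\ good F, E `<=` F & forall G, good G -> E `<=` G ->
      fine (P G) - fine (P E) <= 2 * (fine (P F) - fine (P E))].
  have [gE|] := pselect (good E); last by exists set0.
  pose S := [set fine (P G) | G in [set G | good G /\ E `<=` G]].
  have hS : has_sup S.
    split; first by exists (fine (P E)), E => //; split.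
    by exists c => _ [G [[_ _ Gc] _] <-].
  have [EltS|SleE] := ltP (fine (P E)) (sup S).
    have e0 : 0 < (sup S - fine (P E)) / 2 by lra.
    have [_ [F [gF EF] <-] Fsup] := sup_adherent e0 hS.
    exists F => _; split => // G gG EG.
    have : fine (P G) <= sup S by apply: sup_upper_bound => //; exists G.
    lra.
  exists E => _; split => // G gG EG.
  have : fine (P G) <= sup S by apply: sup_upper_bound => //; exists G.
  lra.
have [nxt nxtP] := choice next.
pose E n := iter n nxt set0.
have gE n : good (E n).
  elim: n => [|n IH]; last by have [] := nxtP _ IH.
  by split; [exact: measurable0|exact: sub0set|rewrite /E/= measure0].
have mE n : measurable (E n) by have [] := gE n.
have EE n : E n `<=` E n.+1 by have [] := nxtP _ (gE n).
have ndE : nondecreasing_seq E.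
  by apply/nondecreasing_seqP => n; apply/subsetPset.
pose U := \bigcup_n E n.
have mU : measurable U by exact: bigcupT_measurable.
have UA : U `<=` A by apply: bigcup_sub => n _; have [] := gE n.
have EU n : E n `<=` U by exact: bigcup_sup.
have cvgE : fine (P (E n)) @[n --> \oo] --> fine (P U).
  have PU : P U = (fine (P U))%:E by rewrite fineK//; exact: fin_num_measure.
  apply/fine_cvg; rewrite -PU; exact: nondecreasing_cvg_mu.
have Uc : fine (P U) <= c.
  rewrite -(cvg_lim _ cvgE)//; apply: limr_le.
    by apply/cvg_ex; eexists; exact: cvgE.
  by apply: nearW => n; have [] := gE n.
exists U; split => //; apply/eqP; rewrite eq_le Uc/= leNgt; apply/negP => Ultc.
(* If [U] falls short of [c], a piece [F] of [A] minus [U] fits into the deficit, so [U] with [F]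
   added is an admissible enlargement of every [E n]. *)
have [|||F [mF FAU /andP[F0 Fc]]] := @atomless_subset_lt (A `\` U) (c - fine (P U)).
- exact: measurableD.
- by rewrite fine_probD//; lra.
- by rewrite subr_gt0.
have UF0 : U `&` F = set0.
  by rewrite -subset0 => x [Ux /FAU[]].
have gUF : good (U `|` F).
  split; first exact: measurableU.
  - by move=> x [/UA//|/FAU[]].
  - by rewrite fine_probU//; lra.
(* For this [n], step [n] gains less than a quarter of [P F], whereas the choice of [nxt] forces a
   gain of at least half of [P F]. *)
have [n nU] : exists n, fine (P U) - fine (P (E n)) < fine (P F) / 4.
  move/cvgr_dist_lt : cvgE => /(_ (fine (P F) / 4)).
  rewrite divr_gt0// => /(_ isT)[n _ /(_ n (leqnn n))/= dn].
  by exists n; apply: le_lt_trans dn; exact: ler_norm.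
have [_ _ /(_ _ gUF)] := nxtP _ (gE n).
have EUF : E n `<=` U `|` F by move=> x /EU; left.
have := @le_fine_prob _ _ (mE n.+1) mU (EU n.+1).
move=> Sn /(_ EUF); rewrite fine_probU// -/(E n.+1).
move: nU Sn F0; rewrite /E/=.
move: (fine (P (iter n nxt set0))) (fine (P (nxt _))) => x y.
lra.
Qed.

End atomless.

(** * Distortion integrals split at zero; values on step functions *)

Section distortion_integrals.
Set Implicit Arguments.
Unset Strict Implicit.
Context d (T : measurableType d) (R : realType) (P : probability T R).
Variables (h : R -> R) (h_dist : distortion h).
Local Notation mu := (@lebesgue_measure R).
Local Notation rho := (distortion_rm P h).
Implicit Types (X Y : T -> R) (A B : set T).

Definition tail_prob X (x : R) : R := fine (P [set w | x < X w]).

Definition pos_part_rm X : \bar R :=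
  (\int[mu]_(x in `[0%R, +oo[) (h (tail_prob X x))%:E)%E.

(** The null point 0 is removed from the interval of [distortion_rm]: for [X >= 0] the integrand
    then vanishes throughout, whereas at 0 it would be [h (P (X > 0)) - 1]. *)
Definition neg_part_rm X : \bar R :=
  (\int[mu]_(x in `]-oo, 0%R[) (h (tail_prob X x) - 1)%:E)%E.

Lemma measurable_gt X x : measurable_fun setT X -> measurable [set w | x < X w].
Proof.
move=> mX; have := mX measurableT _ (measurable_itv `]x, +oo[).
by rewrite setTI; congr measurable; apply/seteqP; split => w /=;
  rewrite in_itv/= andbT.
Qed.

Lemma tail_prob01 X x : measurable_fun setT X -> tail_prob X x \in `[0, 1].
Proof.
move=> mX; rewrite in_itv/= fine_prob_ge0 fine_prob_le1//.
exact: measurable_gt.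
Qed.

Lemma distortion_ge0 t : t \in `[0, 1] -> 0 <= h t.
Proof. by move=> /(distortion_range h_dist); rewrite in_itv => /andP[]. Qed.

Lemma distortion_le1 t : t \in `[0, 1] -> h t <= 1.
Proof. by move=> /(distortion_range h_dist); rewrite in_itv => /andP[]. Qed.

(** A composite of the nondecreasing [h] with the nonincreasing tail is monotone, hence Borel. *)
Lemma measurable_distortion_tail X (D : set R) : measurable_fun setT X ->
  measurable_fun D (fun x => h (tail_prob X x)).
Proof.
move=> mX; apply: measurable_funTS.
apply: nonincreasing_measurable => // x y xy.
apply: (distortion_ndecr h_dist); rewrite ?tail_prob01//.
apply: le_fine_prob; [exact: measurable_gt..|].
by move=> w /=; exact: le_lt_trans.
Qed.

Lemma distortion_rmE X : measurable_fun setT X ->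
  rho X = (pos_part_rm X + neg_part_rm X)%E.
Proof.
move=> mX; rewrite /distortion_rm; congr (_ + _)%E.
rewrite -integral_itv_bndo_bndc//.
apply/measurable_EFinP; apply: measurable_funB => //.
exact: measurable_distortion_tail.
Qed.

Lemma eq_pos_part_rm X Y : (forall x w, 0 <= x -> (x < X w) = (x < Y w)) ->
  pos_part_rm X = pos_part_rm Y.
Proof.
move=> XY; apply: eq_integral => x /[!inE]/=; rewrite in_itv/= andbT => x0.
by rewrite /tail_prob (eq_set (fun w => congr1 is_true (XY x w x0))).
Qed.

Lemma eq_neg_part_rm X Y : (forall x w, x < 0 -> (x < X w) = (x < Y w)) ->
  neg_part_rm X = neg_part_rm Y.
Proof.
move=> XY; apply: eq_integral => x /[!inE]/=; rewrite in_itv/= => x0.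
by rewrite /tail_prob (eq_set (fun w => congr1 is_true (XY x w x0))).
Qed.

Lemma pos_part_rm0 X : (forall w, X w <= 0) -> pos_part_rm X = 0%E.
Proof.
move=> X0; apply: integral0_eq => x /=; rewrite in_itv/= andbT => x0.
rewrite /tail_prob (_ : [set _ | _] = set0) ?measure0 ?(distortion0 h_dist)//.
by rewrite -subset0 => w /=; rewrite ltNge (le_trans (X0 w)).
Qed.

Lemma neg_part_rm0 X : (forall w, 0 <= X w) -> neg_part_rm X = 0%E.
Proof.
move=> X0; apply: integral0_eq => x /=; rewrite in_itv/= => x0.
rewrite /tail_prob (_ : [set _ | _] = setT) ?probability_setT.
  by rewrite /= (distortion1 h_dist) subrr.
by rewrite -subTset => w _ /=; rewrite (lt_le_trans x0).
Qed.

Lemma distortion_rm_ge0E X : measurable_fun setT X -> (forall w, 0 <= X w) ->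
  rho X = pos_part_rm X.
Proof. by move=> mX X0; rewrite distortion_rmE// neg_part_rm0// adde0. Qed.

Lemma distortion_rm_le0E X : measurable_fun setT X -> (forall w, X w <= 0) ->
  rho X = neg_part_rm X.
Proof. by move=> mX X0; rewrite distortion_rmE// pos_part_rm0// add0e. Qed.

(** An instance of comonotonic additivity: [X] has the upper level sets of its positive part at
    levels [x >= 0], and those of minus its negative part at levels [x < 0]. *)
Lemma distortion_rm_posneg X : measurable_fun setT X ->
  rho X = (rho (X^\+)%R + rho (fun w => - X^\- w)%R)%E.
Proof.
move=> mX.
have mXn : measurable_fun setT (fun w => - X^\- w).
  by apply: measurableT_comp => //; exact: measurable_funrneg.
rewrite distortion_rmE// distortion_rm_ge0E ?distortion_rm_le0E//.
- congr (_ + _)%E.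
    apply: eq_pos_part_rm => x w x0.
    by rewrite /funrpos lt_max (ltNge x 0) x0 orbF.
  apply: eq_neg_part_rm => x w x0.
  by rewrite /funrneg ltrNr gt_max ltrN2 oppr_gt0 x0 andbT.
- by move=> w; rewrite oppr_le0 funrneg_ge0.
- exact: measurable_funrpos.
Qed.

(** The variable is 1 on [B], 1/2 on the rest of [A] and 0 elsewhere, so its tail is [P A] on [[0,
    1/2[], [P B] on [[1/2, 1[] and 0 beyond. This value is what turns convexity of the risk measure
    into midpoint concavity of [h]. *)
Lemma distortion_rm_step A B : measurable A -> measurable B -> B `<=` A ->
  rho (fun w => 2^-1 * \1_A w + (1 - 2^-1) * \1_B w)
  = (2^-1 * h (fine (P A)) + 2^-1 * h (fine (P B)))%:E.
Proof.
move=> mA mB BA; set X := fun w => _.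
have XE w : X w = if w \in B then 1 else if w \in A then 2^-1 else 0.
  rewrite /X !indicE; have [/set_mem/BA/mem_set ->|_] := boolP (w \in B).
    by rewrite /=; lra.
  by case: (w \in A); rewrite /=; lra.
have mX : measurable_fun setT X.
  by apply: measurable_funD; apply: measurable_funM => //; exact: measurable_indic.
rewrite distortion_rm_ge0E//; last first.
  by move=> w; rewrite XE; case: ifP => // _; case: ifP => // _; rewrite invr_ge0.
have h0 C : measurable C -> 0 <= h (fine (P C)).
  by move=> mC; rewrite distortion_ge0// in_itv/= fine_prob_ge0 fine_prob_le1.
transitivity (\int[mu]_(x in `[0%R, +oo[)
    ((h (fine (P A)))%:E * (\1_(`[0, 2^-1[ : set R) x)%:E
     + (h (fine (P B)))%:E * (\1_(`[2^-1, 1[ : set R) x)%:E))%E.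
  apply: eq_integral => x /[!inE]/=; rewrite in_itv/= andbT => x0.
  rewrite !indicE !mem_setE !in_itv/= x0/=.
  have [x2|x2] := ltP x 2^-1.
    rewrite mule1 mule0 adde0 /tail_prob (_ : [set w | _] = A)//.
    apply/seteqP; split => w /=; rewrite XE.
      by case: ifPn => [/set_mem/BA//|_]; case: ifPn => [/set_mem//|_]; lra.
    by move=> /mem_set ->; case: ifP => _; lra.
  have [x1|x1] := ltP x 1.
    rewrite mule1 mule0 add0e /tail_prob (_ : [set w | _] = B)//.
    apply/seteqP; split => w /=; rewrite XE.
      by case: ifPn => [/set_mem//|_]; case: ifPn => _; lra.
    by move=> /mem_set ->.
  rewrite !mule0 adde0 /tail_prob (_ : [set w | _] = set0).
    by rewrite measure0 (distortion0 h_dist).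
  rewrite -subset0 => w /=; rewrite XE.
  by case: ifPn => [_|_]; [|case: ifPn => _]; lra.
rewrite ge0_integralD//=; last 4 first.
- by move=> x _; rewrite lee_fin mulr_ge0 ?h0.
- by apply/measurable_EFinP/measurable_funM => //; exact: measurable_indic.
- by move=> x _; rewrite lee_fin mulr_ge0 ?h0.
- by apply/measurable_EFinP/measurable_funM => //; exact: measurable_indic.
rewrite !ge0_integralZl_EFin ?h0//=; last 2 first.
- exact/measurable_EFinP/measurable_indic.
- exact/measurable_EFinP/measurable_indic.
rewrite !integral_indic//.
rewrite (_ : _ `&` _ = `[0, 2^-1[%classic); last first.
  by apply/setIidl => x /=; rewrite !in_itv/= andbT => /andP[].
rewrite (_ : _ `&` _ = `[2^-1, 1[%classic); last first.
  by apply/setIidl => x /=; rewrite !in_itv/= andbT => /andP[x2 _]; lra.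
have muE (a b : R) : a < b -> lebesgue_measure `[a, b[%classic = (b - a)%:E.
  by move=> ab; rewrite lebesgue_measure_itv/= lte_fin ab EFinB.
transitivity ((h (fine (P A)))%:E * (2^-1 - 0)%:E
              + (h (fine (P B)))%:E * (1 - 2^-1)%:E)%E.
  by congr (_ * _ + _ * _)%E; apply: muE; lra.
by rewrite -!EFinM -EFinD; congr EFin; lra.
Qed.

Lemma distortion_rm_indic A : measurable A -> rho \1_A = (h (fine (P A)))%:E.
Proof.
move=> mA; rewrite (_ : \1_A = fun w => 2^-1 * \1_A w + (1 - 2^-1) * \1_A w).
  by rewrite distortion_rm_step//; congr EFin; lra.
by apply/funext => w; lra.
Qed.

(** For the identity distortion the two integrals are those of the tail formula for the expectation,
    the cdf being 1 minus the tail. *)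
Lemma distortion_rm_id X : X \in Lfun P 1 -> {in `[0, 1], forall t, h t = t} ->
  rho X = 'E_P[X]%E.
Proof.
move=> XL hid; have mX : measurable_fun setT X by exact: set_mem (sub_Lfun_mfun XL).
pose X' : {RV P >-> R} := mfun_Sub (mem_set mX).
rewrite distortion_rmE// -[RHS]/('E_P[X'])%E expectation_cdf_ccdf//.
have ccdfE x : ccdf X' x = (tail_prob X x)%:E.
  rewrite /tail_prob fineK ?fin_num_measure//; last exact: measurable_gt.
  rewrite /ccdf /distribution /pushforward/=; congr (P _).
  by apply/seteqP; split => w /=; rewrite in_itv/= andbT.
congr (_ + _)%E.
  by apply: eq_integral => x _; rewrite ccdfE hid// tail_prob01.
rewrite -integral_ge0N//; apply: eq_integral => x _.
by rewrite cdf_1_ccdf ccdfE hid ?tail_prob01// -EFinB -EFinN opprB.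
Qed.

End distortion_integrals.

(** * Normalisation and subadditivity of coherent risk measures *)

Section coherent_theory.
Set Implicit Arguments.
Unset Strict Implicit.
Context d (T : measurableType d) (R : realType) (P : probability T R).
Variables (rho : (T -> R) -> \bar R) (rho_coh : coherent P rho).
Implicit Types X Y : T -> R.

Lemma Lfun1_scale X (a : R) : X \in Lfun P 1 -> (fun w => a * X w) \in Lfun P 1.
Proof.
move=> /Lfun1_integrable X1; apply/Lfun1_integrable.
exact: (integrableZl measurableT a X1).
Qed.

(** Homogeneity gives [rho 0 = 2 rho 0], and this value is finite. *)
Lemma coherent0 : rho (cst 0) = 0%E.
Proof.
have L0 : cst 0 \in Lfun P 1 by exact: Lfun_cst.
have := coherent_homog rho_coh L0 (ltr0n R 2).
rewrite (_ : (fun _ => _) = cst 0); last by apply/funext => w; rewrite mulr0.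
have /fineK <- := coherent_cst rho_coh 0.
by rewrite -EFinM => -[] r2; congr EFin; lra.
Qed.

(** Convexity with weight 1/2 at [2 X] and [2 Y]; homogeneity cancels the factors. *)
Lemma coherent_subadd X Y : X \in Lfun P 1 -> Y \in Lfun P 1 ->
  (rho (fun w => X w + Y w)%R <= rho X + rho Y)%E.
Proof.
move=> XL YL; have half : 0 < (2^-1 : R) < 1 by lra.
have := coherent_convex rho_coh (Lfun1_scale 2 XL) (Lfun1_scale 2 YL) half.
rewrite !(coherent_homog rho_coh)//.
have cancel2 (k : R) (x : \bar R) : k * 2 = 1 -> (k%:E * (2%:E * x) = x)%E.
  by move=> k2; rewrite muleA -EFinM k2 mul1e.
rewrite !cancel2; [|lra..]; congr (rho _ <= _)%E.
by apply/funext => w; lra.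
Qed.

Lemma coherent_ge0 X : X \in Lfun P 1 -> (forall w, 0 <= X w) -> (0 <= rho X)%E.
Proof.
move=> XL X0; rewrite -coherent0; apply: (coherent_mono rho_coh) => //.
- exact: Lfun_cst.
- exact: aeW.
Qed.

Lemma coherent_opp X : X \in Lfun P 1 -> (0 <= rho X + rho (fun w => - X w)%R)%E.
Proof.
move=> XL; rewrite -coherent0.
have -> : cst 0 = (fun w => X w + - X w) by apply/funext => w; rewrite subrr.
by apply: coherent_subadd => //; rewrite -[X in X \in _]/(- X) rpredN.
Qed.

End coherent_theory.

(* Halving towards the nearer endpoint: [g l <= g l' / 2] for some [l'], so that
   [g l <= 2 ^- n] for every [n]. *)
Lemma bounded_midpoint_convex_le0 (R : realType) (g : R -> R) :
  {in `[0, 1], forall l : R, g l <= 1} ->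
  {in `[0, 1] &, forall x y, g ((x + y) / 2) <= (g x + g y) / 2} ->
  g 0 <= 0 -> g 1 <= 0 -> {in `[0, 1], forall l : R, g l <= 0}.
Proof.
move=> g1 gmid g0 g10.
have pow2 n : {in `[0, 1], forall l, g l * 2 ^+ n <= 1}.
  elim: n => [|n IH] l l01; first by rewrite expr0 mulr1 g1.
  have n0 : 0 < 2 ^+ n :> R by rewrite exprn_gt0.
  suff [x x01 gx] : exists2 x, x \in `[0, 1] & g l * 2 <= g x.
    by rewrite exprS mulrA (le_trans _ (IH x x01))// ler_wpM2r// ltW.
  move: (l01); rewrite in_itv/= => /andP[l0 l1].
  have in0 : (0 : R) \in `[0, 1] by rewrite in_itv/= lexx ler01.
  have in1 : (1 : R) \in `[0, 1] by rewrite in_itv/= lexx ler01.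
  have [l2|l2] := leP l 2^-1.
    have x01 : 2 * l \in `[0, 1] by rewrite in_itv/=; lra.
    exists (2 * l) => //; have := gmid _ _ in0 x01.
    by rewrite (_ : (0 + 2 * l) / 2 = l); lra.
  have x01 : 2 * l - 1 \in `[0, 1] by rewrite in_itv/=; lra.
  exists (2 * l - 1) => //; have := gmid _ _ in1 x01.
  by rewrite (_ : (1 + (2 * l - 1)) / 2 = l); lra.
move=> l l01; rewrite leNgt; apply/negP => gl0.
have gl := archi_boundP (ltW (eqbRL (invr_gt0 (g l)) gl0)).
have := pow2 (Num.bound (g l)^-1) l l01; apply/negP; rewrite -ltNge.
rewrite -[ltLHS](mulfV (lt0r_neq0 gl0)) ltr_pM2l// (lt_trans gl)//.
by rewrite -natrX ltr_nat ltn_expl.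
Qed.

(** * Concavity of the distortion function *)

Section distortion_concave.
Set Implicit Arguments.
Unset Strict Implicit.
Context d (T : measurableType d) (R : realType) (P : probability T R).
Hypothesis P_atomless : atomless P.
Variables (h : R -> R) (h_dist : distortion h).
Hypothesis rho_coh : coherent P (distortion_rm P h).

Lemma Lfun1_indic (A : set T) : measurable A -> \1_A \in Lfun P 1.
Proof. by move=> mA; apply/Lfun1_integrable; exact: integrable_indic. Qed.

(* With [P U = t], [P S = s] and [S] included in [U], the indicators of two
   sets of probability [(s + t) / 2] with union [U] and intersection [S] have
   the same sum as those of [U] and [S]. *)
Lemma distortion_midpoint (s t : R) : 0 <= s -> s <= t -> t <= 1 ->
  (h s + h t) / 2 <= h ((s + t) / 2).
Proof.
move=> s0 st t1.
have [||U [mU _ PU]] := @atomless_subset _ _ _ P P_atomless setT t.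
- exact: measurableT.
- by rewrite probability_setT/=; lra.
have [||A [mA AU PA]] := @atomless_subset _ _ _ P P_atomless U ((s + t) / 2).
- exact: mU.
- by rewrite PU; lra.
have [||S [mS SA PS]] := @atomless_subset _ _ _ P P_atomless A s.
- exact: mA.
- by rewrite PA; lra.
pose B := S `|` (U `\` A).
have mUA : measurable (U `\` A) by exact: measurableD.
have mB : measurable B by exact: measurableU.
have PB : fine (P B) = (s + t) / 2.
  rewrite fine_probU//; first by rewrite fine_probD// PU PA PS; lra.
  by rewrite -subset0 => w [/SA ? []].
have half : 0 < (2^-1 : R) < 1 by lra.
have := coherent_convex rho_coh (Lfun1_indic mA) (Lfun1_indic mB) half.
rewrite !(distortion_rm_indic P h_dist)// PA PB.
rewrite (_ : (fun _ => _) = fun w => 2^-1 * \1_U w + (1 - 2^-1) * \1_S w).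
  rewrite (distortion_rm_step P h_dist)//; last exact: subset_trans AU.
  by rewrite -!EFinM -EFinD lee_fin PU PS; lra.
apply/funext => w; rewrite !indicE.
have [/set_mem wU|wU] := boolP (w \in U); last first.
  have /negbTE -> : w \notin A by apply: contra wU => /set_mem/AU/mem_set.
  have /negbTE -> : w \notin B.
    by apply: contra wU => /set_mem[/SA/AU/mem_set//|[/mem_set]].
  have /negbTE -> : w \notin S by apply: contra wU => /set_mem/SA/AU/mem_set.
  by [].
have [/set_mem wS|wS] := boolP (w \in S).
  rewrite (mem_set (SA _ wS)) (_ : w \in B)//.
  by apply: mem_set; left.
have [wA|wA] := boolP (w \in A).
  have /negbTE -> : w \notin B.
    by apply/negP => /set_mem[/mem_set|[_ /(_ (set_mem wA))//]]; apply/negP.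
  by rewrite /=; lra.
have -> : w \in B.
  by apply: mem_set; right; split => // /mem_set; apply/negP.
by rewrite /=; lra.
Qed.

(** The chord minus [h] is midpoint convex, vanishes at both ends and is at most 1; this upper bound
    is what lets midpoint convexity suffice. *)
Lemma distortion_concave (s t l : R) : 0 <= s -> s <= t -> t <= 1 ->
  l \in `[0, 1] -> h s + l * (h t - h s) <= h (s + l * (t - s)).
Proof.
move=> s0 st t1 l01; rewrite -subr_le0.
pose g l := h s + l * (h t - h s) - h (s + l * (t - s)).
have line x : x \in `[0, 1] -> 0 <= s + x * (t - s) <= 1.
  by rewrite in_itv/= => /andP[x0 x1]; nra.
have ht : h t <= 1 by apply: (distortion_le1 h_dist); rewrite in_itv/=; lra.
have hs : 0 <= h s by apply: (distortion_ge0 h_dist); rewrite in_itv/=; lra.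
have hst : h s <= h t.
  by apply: (distortion_ndecr h_dist) => //; rewrite in_itv/=; lra.
apply: (@bounded_midpoint_convex_le0 _ g) => //.
- move=> x x01; have := line _ x01.
  rewrite -[_ && _]/(s + x * (t - s) \in `[0, 1]) => /(distortion_ge0 h_dist).
  by move: x01; rewrite /g in_itv/= => /andP[x0 x1]; nra.
- move=> x y; wlog xy : x y / x <= y => [W|] x01 y01.
    have [xy|/ltW yx] := leP x y; first exact: W.
    by rewrite [x + y]addrC [g x + _]addrC; exact: W.
  have /andP[lx0 lx1] := line _ x01; have /andP[ly0 ly1] := line _ y01.
  have lxy : s + x * (t - s) <= s + y * (t - s) by nra.
  have := distortion_midpoint lx0 lxy ly1; rewrite /g.
  rewrite (_ : (s + x * (t - s) + _) / 2 = s + (x + y) / 2 * (t - s)); last by lra.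
  by lra.
- by rewrite /g !mul0r !addr0 subrr.
- by rewrite /g !mul1r !subrKC subrr.
Qed.

(** Write [a = h (1/2)]. The chord over [[0, 1/2]] gives [2 t a <= h t], the one over [[1/2, 1]]
    gives [1 - h (1 - t) <= 2 t (1 - a)]; both sides are compared with [2 t a (1 - a)]. *)
Lemma distortion_half_bound (t : R) : 0 <= t <= 2^-1 ->
  h 2^-1 * (1 - h (1 - t)) <= (1 - h 2^-1) * h t.
Proof.
move=> /andP[t0 t2].
have half01 : (2^-1 : R) \in `[0, 1] by rewrite in_itv/=; lra.
have a0 := distortion_ge0 h_dist half01; have a1 := distortion_le1 h_dist half01.
have lo : 2 * t * h 2^-1 <= h t.
  have := @distortion_concave 0 2^-1 (2 * t).
  rewrite (distortion0 h_dist) in_itv/= (_ : 0 + 2 * t * (2^-1 - 0) = t); last by lra.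
  by move=> H; apply: (le_trans _ (H _ _ _ _)); lra.
have hi : h 2^-1 + (1 - 2 * t) * (1 - h 2^-1) <= h (1 - t).
  have := @distortion_concave 2^-1 1 (1 - 2 * t).
  rewrite (distortion1 h_dist) in_itv/=.
  rewrite (_ : 2^-1 + (1 - 2 * t) * (1 - 2^-1) = 1 - t); last by lra.
  by apply; lra.
have h1 : h 2^-1 * (1 - h (1 - t)) <= h 2^-1 * (2 * t * (1 - h 2^-1)).
  by rewrite ler_wpM2l//; lra.
have h2 : (1 - h 2^-1) * (2 * t * h 2^-1) <= (1 - h 2^-1) * h t.
  by rewrite ler_wpM2l//; lra.
lra.
Qed.

(** Concavity puts [h] above the diagonal, strictly at some interior [t]. The chord from [(t, h t)]
    to the corner [(0, 0)] or [(1, 1)] on the other side of 1/2 is then strictly above the diagonal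
    at 1/2. *)
Lemma distortion_half_gt : ~ {in `[0, 1], forall t : R, h t = t} -> 2^-1 < h 2^-1.
Proof.
move=> /existsNP[t /not_implyP[]]; rewrite in_itv/= => /andP[t0 t1] htt.
have {htt} ht : t < h t.
  rewrite lt_neqAle eq_sym; apply/andP; split; first exact/eqP.
  have := @distortion_concave 0 1 t.
  rewrite (distortion0 h_dist) (distortion1 h_dist) in_itv/= add0r !subr0 !mulr1.
  by apply; lra.
have t0' : t != 0 by apply: contraTneq ht => ->; rewrite (distortion0 h_dist) ltxx.
have t1' : t != 1 by apply: contraTneq ht => ->; rewrite (distortion1 h_dist) ltxx.
have {}t0 : 0 < t by lra.
have {}t1 : t < 1 by lra.
have [t2|t2] := leP t 2^-1.
  pose l := (2^-1 - t) / (1 - t).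
  have lE : l * (1 - t) = 2^-1 - t by rewrite mulfVK//; lra.
  have l01 : 0 <= l < 1.
    by rewrite divr_ge0 ?subr_ge0 ?(ltW t1)//= ltr_pdivrMr ?subr_gt0//; lra.
  have := @distortion_concave t 1 l.
  rewrite (distortion1 h_dist) in_itv/= lE (_ : t + (2^-1 - t) = 2^-1); last by lra.
  have : (1 - l) * t < (1 - l) * h t by rewrite ltr_pM2l//; lra.
  by move=> lt H; apply: lt_le_trans (H _ _ _ _); lra.
pose l := 2^-1 / t.
have lE : l * t = 2^-1 by rewrite mulfVK.
have l01 : 0 < l <= 1 by rewrite divr_gt0//= ler_pdivrMr//; lra.
have := @distortion_concave 0 t l.
rewrite (distortion0 h_dist) in_itv/= add0r !subr0 add0r lE.
have : l * t < l * h t by rewrite ltr_pM2l//; lra.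
by move=> lt H; apply: lt_le_trans (H _ _ _ _); lra.
Qed.

End distortion_concave.

(** * Bounds on the folding score *)

Section folding.
Set Implicit Arguments.
Unset Strict Implicit.
Context d (T : measurableType d) (R : realType) (P : probability T R).
Hypothesis P_atomless : atomless P.
Variables (h : R -> R) (h_dist : distortion h).
Hypothesis rho_coh : coherent P (distortion_rm P h).
Local Notation mu := (@lebesgue_measure R).
Local Notation rho := (distortion_rm P h).
Local Notation a := (h 2^-1).
Implicit Types X Y : T -> R.

Lemma measurable_Lfun1 X : X \in Lfun P 1 -> measurable_fun setT X.
Proof. by move=> XL; exact: set_mem (sub_Lfun_mfun XL). Qed.

Lemma half_bounds : 0 <= a <= 1.
Proof.
have half01 : (2^-1 : R) \in `[0, 1] by rewrite in_itv/=; lra.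
by rewrite (distortion_ge0 h_dist)//= (distortion_le1 h_dist).
Qed.

(* The factor [l > 1] absorbs the difference between [P (x <= Y)], which comes
   from [- Y], and [P (x < Y)]. *)
Lemma neg_part_rm_opp_le Y (l : R) : measurable_fun setT Y ->
  (forall w, 0 <= Y w) -> fine (P [set w | 0 < Y w]) <= 2^-1 -> 1 < l ->
  (a%:E * - neg_part_rm P h (fun w => - Y w)%R
   <= (1 - a)%:E * pos_part_rm P h (fun w => l * Y w)%R)%E.
Proof.
move=> mY Y0 PY l1; have /andP[a0 a1] := half_bounds.
have mYN : measurable_fun setT (fun w => - Y w) by exact: measurableT_comp.
have mlY : measurable_fun setT (fun w => l * Y w) by exact: measurable_funM.
pose f x := 1 - h (tail_prob P (fun w => - Y w) x).
pose g x := h (tail_prob P (fun w => l * Y w) x).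
have f0 x : 0 <= f x by rewrite subr_ge0 (distortion_le1 h_dist)// tail_prob01.
have g0 x : 0 <= g x by rewrite (distortion_ge0 h_dist)// tail_prob01.
have mf : measurable_fun setT f.
  by apply: measurable_funB => //; exact: measurable_distortion_tail.
have mg : measurable_fun setT g by exact: measurable_distortion_tail.
have mgN : measurable_fun setT (fun x : R => g (- x)).
  by apply: (measurableT_comp mg).
have -> : (- neg_part_rm P h (fun w => - Y w)%R
    = \int[mu]_(x in `]-oo, 0%R[) (f x)%:E)%E.
  transitivity (- \int[mu]_(x in `]-oo, 0%R[) - (f x)%:E)%E.
    congr (- _)%E; apply: eq_integral => x _.
    by rewrite /f -EFinN opprB.
  by rewrite integral_ge0N ?oppeK// => x _; rewrite lee_fin.
(* The reflection [x -> - x] brings both integrals to the same half-line, where the integrands are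
   compared pointwise. *)
have -> : (pos_part_rm P h (fun w => l * Y w)%R
    = \int[mu]_(x in `]-oo, 0%R[) (g (- x))%:E)%E.
  rewrite integral_itv_bndo_bndc; last first.
    by apply/measurable_EFinP; exact: measurable_funTS.
  rewrite -(ge0_integration_by_substitution0 (f := EFin \o g))//.
  exact/measurable_EFinP.
rewrite -!ge0_integralZl_EFin//=; last 5 first.
- by move=> x _; rewrite lee_fin.
- by apply/measurable_EFinP; exact: measurable_funTS.
- by rewrite subr_ge0.
- by move=> x _; rewrite lee_fin.
- by apply/measurable_EFinP; exact: measurable_funTS.
apply: ge0_le_integral => //=.
- by move=> x _; rewrite lee_fin mulr_ge0.
- apply/measurable_EFinP; apply: measurable_funM => //; exact: measurable_funTS.
- apply/measurable_EFinP; apply: measurable_funM => //; exact: measurable_funTS.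
move=> x; rewrite in_itv/= => x0; rewrite lee_fin /f /g.
pose t := fine (P [set w | - x <= Y w]).
have mle : measurable [set w | - x <= Y w].
  rewrite (_ : [set _ | _] = ~` [set w | x < - Y w]).
    by apply: measurableC; exact: measurable_gt.
  by apply/seteqP; split => w /=; [move=> xY; apply/negP|move/negP];
    rewrite -leNgt lerNl.
have -> : tail_prob P (fun w => - Y w) x = 1 - t.
  rewrite -fine_probC// /tail_prob; congr (fine (P _)).
  by apply/seteqP; split => w /=; [move=> xY; apply/negP|move/negP];
    rewrite -ltNge ltrNr.
(* Since [- x > 0], the event [- x <= Y] lies in [0 < Y]. *)
have t2 : 0 <= t <= 2^-1.
  rewrite fine_prob_ge0 (le_trans _ PY)// le_fine_prob//.
    exact: measurable_gt.
  by move=> w /=; apply: lt_le_trans; rewrite oppr_gt0.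
apply: le_trans (distortion_half_bound P_atomless h_dist rho_coh t2) _.
rewrite ler_wpM2l ?subr_ge0//; apply: (distortion_ndecr h_dist).
- by move/andP: t2 => [t0 t2]; rewrite in_itv/= t0 (le_trans t2)//; lra.
- exact: tail_prob01.
- apply: le_fine_prob => //; first exact: measurable_gt.
  by move=> w /= xY; nra.
Qed.

(** Homogeneity turns the value at [l Y] into [l p]; then [l] is let decrease to 1. *)
Lemma distortion_rm_opp_bound Y (p u : R) : Y \in Lfun P 1 ->
  (forall w, 0 <= Y w) -> fine (P [set w | 0 < Y w]) <= 2^-1 ->
  rho Y = p%:E -> rho (fun w => - Y w) = u%:E -> a * - u <= (1 - a) * p.
Proof.
move=> YL Y0 PY Yp Yu; have /andP[a0 a1] := half_bounds.
have mY := measurable_Lfun1 YL.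
have p0 : 0 <= p by rewrite -lee_fin -Yp (coherent_ge0 rho_coh).
have mYN : measurable_fun setT (fun w => - Y w) by exact: measurableT_comp.
apply/ler_addgt0Pr => e e0.
have k0 : 0 < (1 - a) * p + 1 by rewrite ltr_wpDl// mulr_ge0// subr_ge0.
(* Chosen so that [l (1 - a) p] exceeds [(1 - a) p] by at most [e]; the added 1 keeps the
   denominator positive. *)
pose l := 1 + e / ((1 - a) * p + 1).
have l1 : 1 < l by rewrite ltrDl divr_gt0.
have := neg_part_rm_opp_le mY Y0 PY l1.
rewrite -(distortion_rm_le0E P h_dist mYN) => [|w]; last by rewrite oppr_le0.
rewrite -(distortion_rm_ge0E P h_dist); last 2 first.
- by apply: measurable_funM.
- by move=> w; rewrite mulr_ge0// ltW// (lt_trans ltr01).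
rewrite (coherent_homog rho_coh YL) ?(lt_trans ltr01)// Yp Yu.
rewrite -EFinN -!EFinM lee_fin => /le_trans; apply.
have : e / ((1 - a) * p + 1) * ((1 - a) * p) <= e.
  by rewrite mulrAC ler_pdivrMr// ler_pM2l//; lra.
rewrite /l; lra.
Qed.

(** With [M] the maximum, the hypotheses give [p <= M + q] and [a q <= a M + (1 - a) p]. Eliminating
    [q] yields [(2 a - 1) p <= 2 a M]; substituting back yields [(2 a - 1) q <= M]. *)
Lemma folding_arith (p q u v : R) : 2^-1 < a ->
  0 <= q + v -> a * - u <= (1 - a) * p ->
  (2 * a - 1) * (p + q) <= (2 * a + 1) * Num.max `|p + v| `|q + u|.
Proof.
move=> a2 qv ap; have /andP[a0 a1] := half_bounds.
set M := Num.max _ _.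
have pM : p + v <= M by rewrite le_max (ler_norm (p + v)).
have qM : q + u <= M by rewrite le_max (ler_norm (q + u)) orbT.
have aq : a * q <= a * (M - u) by rewrite ler_wpM2l//; lra.
have apq : a * p <= a * (M + q) by rewrite ler_wpM2l//; lra.
have hp : (2 * a - 1) * p <= 2 * a * M by lra.
have hq : (2 * a - 1) * q <= M.
  have a_gt0 : 0 < a by lra.
  rewrite -(ler_pM2l a_gt0).
  have : (2 * a - 1) * (a * q) <= (2 * a - 1) * (a * M + (1 - a) * p).
    by rewrite ler_wpM2l//; lra.
  have : (1 - a) * ((2 * a - 1) * p) <= (1 - a) * (2 * a * M).
    by rewrite ler_wpM2l//; lra.
  by lra.
by lra.
Qed.

Lemma Lfun1_funrpos X : X \in Lfun P 1 -> (X^\+)%R \in Lfun P 1.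
Proof.
by move=> /Lfun1_integrable XL; exact/Lfun1_integrable/integrable_funrpos.
Qed.

Lemma Lfun1_funrneg X : X \in Lfun P 1 -> (X^\-)%R \in Lfun P 1.
Proof.
by move=> /Lfun1_integrable XL; exact/Lfun1_integrable/integrable_funrneg.
Qed.

Lemma Lfun1_opp X : X \in Lfun P 1 -> (fun w => - X w) \in Lfun P 1.
Proof. by move=> XL; rewrite -[X in X \in _]/(- X) rpredN. Qed.

Local Notation ratio X := (eratio (rho (fun w => `|X w|%R))
  (maxe `|rho X|%E `|rho (fun w => (- X w)%R)|%E)).

Lemma folding_ratio_le X : X \in Lfun P 1 -> 2^-1 < a ->
  fine (P [set w | 0 < X w]) <= 2^-1 ->
  (ratio X <= ((a + 2^-1) / (a - 2^-1))%:E)%E.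
Proof.
move=> XL a2 PX; have /andP[a0 a1] := half_bounds.
have K1 : 1 <= (a + 2^-1) / (a - 2^-1) by rewrite ler_pdivlMr; lra.
have XpL := Lfun1_funrpos XL; have XmL := Lfun1_funrneg XL.
have XmNL := Lfun1_opp XmL; have XpNL := Lfun1_opp XpL.
have absL : (fun w => `|X w|) \in Lfun P 1 by exact: Lfun_norm.
have Xp0 w : 0 <= X^\+ w by exact: funrpos_ge0.
have Xm0 w : 0 <= X^\- w by exact: funrneg_ge0.
have abs0 : (0 <= rho (fun w => `|X w|)%R)%E by exact: (coherent_ge0 rho_coh).
have absp : (rho (X^\+)%R <= rho (fun w => `|X w|)%R)%E.
  apply: (coherent_mono rho_coh) => //; apply: aeW => w.
  by rewrite -[leRHS]/((Num.norm \o X) w) -funrposDneg lerDl.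
have absm : (rho (X^\-)%R <= rho (fun w => `|X w|)%R)%E.
  apply: (coherent_mono rho_coh) => //; apply: aeW => w.
  by rewrite -[leRHS]/((Num.norm \o X) w) -funrposDneg lerDr.
have abspm : (rho (fun w => `|X w|)%R <= rho (X^\+)%R + rho (X^\-)%R)%E.
  rewrite (_ : (fun w => `|X w|) = fun w => X^\+ w + X^\- w).
    exact: (coherent_subadd rho_coh).
  by rewrite -[LHS]/(Num.norm \o X) -funrposDneg.
have rX := distortion_rm_posneg P h_dist (measurable_Lfun1 XL).
have rXN : rho (fun w => - X w)%R
    = (rho (X^\-)%R + rho (fun w => - X^\+ w)%R)%E.
  rewrite (distortion_rm_posneg P h_dist (measurable_Lfun1 (Lfun1_opp XL))).
  have -> : ((fun w => - X w)^\+)%R = (X^\-)%R by exact: funrposN.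
  by have -> : ((fun w => - X w)^\-)%R = (X^\+)%R by exact: funrnegN.
(* The convention [oo / oo = 1] settles this case, the bound being at least 1. *)
have infty : rho (fun w => `|X w|)%R = +oo%E ->
    (maxe `|rho X| `|rho (fun w => - X w)%R|)%E = +oo%E ->
    (ratio X <= ((a + 2^-1) / (a - 2^-1))%:E)%E.
  by move=> -> ->; rewrite /eratio eqxx orbT lee_fin.
(* An infinite [rho X^+] makes [rho |X|] infinite by monotonicity, and [rho X] too because
   [rho (- X^-)] is not [-oo]. The negative part acts likewise on [rho (- X)]. *)
have [pfin|] := boolP (rho (X^\+)%R \is a fin_num); last first.
  rewrite ge0_fin_numE ?(coherent_ge0 rho_coh)// ltey negbK => /eqP py.
  apply: infty; first by apply/eqP; rewrite -leye_eq -py.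
  by rewrite rX py addye ?maxye// gt_eqF// (coherent_gtNy rho_coh).
have [qfin|] := boolP (rho (X^\-)%R \is a fin_num); last first.
  rewrite ge0_fin_numE ?(coherent_ge0 rho_coh)// ltey negbK => /eqP qy.
  apply: infty; first by apply/eqP; rewrite -leye_eq -qy.
  by rewrite rXN qy addye ?maxey// gt_eqF// (coherent_gtNy rho_coh).
have opp_fin Y : Y \in Lfun P 1 -> (forall w, 0 <= Y w) ->
    rho (fun w => - Y w)%R \is a fin_num.
  move=> YL Y0; rewrite fin_numElt (coherent_gtNy rho_coh) ?Lfun1_opp//=.
  apply: (@le_lt_trans _ _ 0%E) => //; rewrite -(coherent0 rho_coh).
  apply: (coherent_mono rho_coh); [exact: Lfun1_opp|exact: Lfun_cst|].
  by apply: aeW => w; rewrite oppr_le0.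
have ufin := opp_fin _ XpL Xp0; have vfin := opp_fin _ XmL Xm0.
have afin : rho (fun w => `|X w|)%R \is a fin_num.
  by rewrite ge0_fin_numE// (le_lt_trans abspm)// ltey_eq fin_numD pfin qfin.
have qv := coherent_opp rho_coh XmL.
have PXp : fine (P [set w | 0 < X^\+ w]) <= 2^-1.
  rewrite (_ : [set _ | _] = [set w | 0 < X w])//.
  by apply/seteqP; split => w /=; rewrite /funrpos lt_max ltxx orbF.
have ap := distortion_rm_opp_bound XpL Xp0 PXp
  (esym (fineK pfin)) (esym (fineK ufin)).
move: abspm qv abs0; rewrite rX rXN -(fineK pfin) -(fineK qfin) -(fineK ufin)
  -(fineK vfin) -(fineK afin) -!EFinD !abse_EFin -EFin_max !lee_fin.
move: ap; move: (fine (rho (X^\+)%R)) (fine (rho (X^\-)%R))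
  (fine (rho (fun w => - X^\+ w)%R)) (fine (rho (fun w => - X^\- w)%R))
  (fine (rho (fun w => `|X w|)%R)) => p q u v s ap spq qv s0.
have := folding_arith a2 qv ap; set M := Num.max _ _ => pqM.
have M0 : 0 <= M by rewrite le_max normr_ge0.
(* A zero denominator forces [p + q <= 0], hence a zero numerator, and the convention [0 / 0 = 1]
   applies. *)
rewrite /eratio; have [M_eq0|M_neq0] := eqVneq M 0.
  have a_gt0 : 0 < 2 * a - 1 by lra.
  have pq0 : p + q <= 0 by rewrite -(pmulr_rle0 _ a_gt0) -(mulr0 (2 * a + 1)) -M_eq0.
  have -> : s = 0 by lra.
  by rewrite M_eq0 eqxx lee_fin.
rewrite !eqe (negbTE M_neq0) !andbF/= inver (negbTE M_neq0) -EFinM lee_fin.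
have M_gt0 : 0 < M by rewrite lt_neqAle eq_sym M_neq0.
by rewrite ler_pdivrMr// mulrAC ler_pdivlMr; lra || nra.
Qed.

(** The ratio is invariant under [X -> - X], and the disjoint events [X > 0] and [- X > 0] cannot
    both have probability above 1/2. *)
Lemma folding_score_le : 2^-1 < a ->
  (folding_score P rho <= ((a + 2^-1) / (a - 2^-1))%:E)%E.
Proof.
move=> a2; apply: ge_ereal_sup => _ [X XL <-].
have [PX|PX] := leP (fine (P [set w | 0 < X w])) (2^-1).
  exact: folding_ratio_le.
have XNL := Lfun1_opp XL.
have XNNE : (fun w => - - X w) = X by apply/funext => w; rewrite opprK.
have absE : (fun w => `|- X w|) = (fun w => `|X w|).
  by apply/funext => w; rewrite normrN.
have := folding_ratio_le XNL a2; rewrite XNNE absE maxC; apply.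
have mX := measurable_gt 0 (measurable_Lfun1 XL).
apply: (@le_trans _ _ (fine (P (~` [set w | 0 < X w])))).
  apply: le_fine_prob; [|exact: measurableC|].
    exact: measurable_gt (measurable_Lfun1 XNL).
  by move=> w /=; rewrite oppr_gt0 => X0; apply/negP; rewrite -leNgt ltW.
by rewrite fine_probC//; lra.
Qed.

(** The zero variable has ratio [0 / 0 = 1]. *)
Lemma folding_score_ge1 : (1 <= folding_score P rho)%E.
Proof.
apply: le_ereal_sup_tmp; exists 1%E => //; exists (cst 0); first exact: Lfun_cst.
have -> : (fun w => `|(cst 0 : T -> R) w|) = cst 0.
  by apply/funext => w; rewrite normr0.
have -> : (fun w => - (cst 0 : T -> R) w) = cst 0.
  by apply/funext => w; rewrite oppr0.
by rewrite (coherent0 rho_coh) abse0 maxxx /eratio eqxx.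
Qed.

Lemma folding_score_mean : (forall X, X \in Lfun P 1 -> rho X = 'E_P[X]%E) ->
  folding_score P rho = +oo%E.
Proof.
move=> rhoE.
have [||B [mB _ PB]] := @atomless_subset _ _ _ P P_atomless setT 2^-1.
- exact: measurableT.
- by rewrite probability_setT/=; lra.
(* The fair sign, 1 on [B] and -1 off it, in a form to which cash invariance and homogeneity
   apply. *)
pose X (w : T) : R := 2 * \1_B w + - 1.
have BL : \1_B \in Lfun P 1 by exact: Lfun1_indic.
have XL : X \in Lfun P 1.
  apply: rpredD; first exact: Lfun1_scale.
  exact: Lfun_cst.
have rX : rho X = 0%E.
  rewrite (coherent_cash rho_coh (-1) (Lfun1_scale 2 BL)).
  rewrite (coherent_homog rho_coh BL)// rhoE// expectation_indic//.
  by rewrite -(@fineK _ (P B)) ?fin_num_measure// PB -EFinM -EFinD; congr EFin; lra.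
have rXN : rho (fun w => - X w) = 0%E.
  rewrite rhoE; last exact: Lfun1_opp.
  have -> : (fun w => - X w) = (-1 \o* X) by apply/funext => w /=; rewrite mulrN1.
  by rewrite expectationZl// -rhoE// rX mule0.
have rA : rho (fun w => `|X w|) = 1%E.
  have -> : (fun w => `|X w|) = cst 1.
    apply/funext => w; rewrite /X indicE.
    by case: (w \in B) => /=; [rewrite ger0_norm|rewrite ler0_norm]; lra.
  by rewrite rhoE ?expectation_cst//; exact: Lfun_cst.
apply/eqP; rewrite -leye_eq; apply: le_ereal_sup_tmp; exists +oo%E => //.
exists X => //; rewrite rA rX rXN abse0 maxxx /eratio eqxx.
by rewrite onee_eq0/= inve0 mul1e.
Qed.

End folding.

Theorem theorem3p1 (d : measure_display) (T : measurableType d) (R : realType)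
    (P : probability T R) (P_atomless : atomless P)
    (h : R -> R) (h_distortion : distortion h)
    (rho_coherent : coherent P (distortion_rm P h)) :
  (~ (forall t : R, t \in `[0, 1] -> h t = t) ->
    [/\ (1 <= folding_score P (distortion_rm P h))%E,
        (folding_score P (distortion_rm P h)
          <= eratio (h (1 / 2) + 1 / 2)%:E (h (1 / 2) - 1 / 2)%:E)%E
      & (eratio (h (1 / 2) + 1 / 2)%:E (h (1 / 2) - 1 / 2)%:E < +oo)%E]) /\
  (folding_score P (distortion_rm P h) = +oo%E <->
    (forall X : T -> R, X \in Lfun P 1 ->
      distortion_rm P h X = 'E_P[X]%E)).
Proof.
rewrite !div1r.
have bound : ~ {in `[0, 1], forall t : R, h t = t} ->
    [/\ (folding_score P (distortion_rm P h)
          <= eratio (h 2^-1 + 2^-1)%:E (h 2^-1 - 2^-1)%:E)%E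
      & (eratio (h 2^-1 + 2^-1)%:E (h 2^-1 - 2^-1)%:E < +oo)%E].
  move=> /(distortion_half_gt P_atomless h_distortion rho_coherent) a2.
  have -> : eratio (h 2^-1 + 2^-1)%:E (h 2^-1 - 2^-1)%:E
      = ((h 2^-1 + 2^-1) / (h 2^-1 - 2^-1))%:E.
    rewrite /eratio !eqe subr_eq0 (gt_eqF a2) !andbF/= inver subr_eq0.
    by rewrite (gt_eqF a2) -EFinM.
  by rewrite ltry; split => //; exact: folding_score_le.
split=> [h_neq|].
  have [le_bound lty] := bound h_neq.
  by split => //; exact: folding_score_ge1.
split=> [sy X XL|]; last exact: folding_score_mean.
(* If [h] were not the identity, an infinite score would contradict the finite bound. *)
apply: distortion_rm_id => //; apply: contrapT => /bound[].
by rewrite sy leye_eq => /eqP ->; rewrite ltxx.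
Qed.
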